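(* Suppose $M$ is unbounded and homogeneous. Let $\mathbf X=(x_1,\dots,x_n)$ be an $n$-tuple of observations on $M$. For any $M$-valued isometric-equivariant estimator $m_n:M^n\to M$, it holds that $$\epsilon^*(m_n,\mathbf X)\ \le\ \Big\lfloor\frac{n+1}{2}\Big\rfloor\Big/n.$$
   Context: $M$ is a smooth Riemannian manifold without boundary, geodesically complete, connected and separable, with Riemannian distance $d$; its sectional curvatures have least upper bound $\Delta<\infty$ and greatest lower bound $\delta>-\infty$. An isometry of $M$ is a map $\psi:M\to M$ with $d\{\psi(x),\psi(y)\}=d(x,y)$ for all $x,y\in M$. $M$ is homogeneous if for any $p,q\in M$ there exists an isometry $\psi$ with $q=\psi(p)$. An estimator $m:M^n\to M$ is isometric-equivariant if for any isometry $\psi$ of $M$ and any $\mathbf X=(x_1,\dots,x_n)\in M^n$, $\psi\{m(\mathbf X)\}=m\{\psi(\mathbf X)\}$, where $\psi(\mathbf X)=(\psi(x_1),\dots,\psi(x_n))$. For $1\le k\le n$, $\mathbf Y_k\in M^n$ denotes a corruption of $\mathbf X$: a tuple consisting of $k$ arbitrary points of $M$ and $n-k$ points from $\mathbf X$ (i.e. $k$ entries of $\mathbf X$ are replaced by arbitrary points). The breakdown point of $m_n$ at $\mathbf X$ is $$\epsilon^*(m_n,\mathbf X)=\min_{1\le k\le n}\Big\{\tfrac kn:\ \sup_{\mathbf Y_k}d(m_n(\mathbf X),m_n(\mathbf Y_k))=\infty\Big\},$$ the supremum being over all possible $\mathbf Y_k$. *)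

(* Defs.v *)
From HB Require Import structures.
From mathcomp Require Import all_boot all_order all_algebra.
From mathcomp Require Import all_classical all_reals all_analysis.

Set Implicit Arguments.
Unset Strict Implicit.
Unset Printing Implicit Defensive.

Import Order.TTheory GRing.Theory Num.Theory.
Import numFieldNormedType.Exports.

Local Open Scope classical_set_scope.
Local Open Scope ring_scope.

Section Smooth.
Context {R : realType} {m : nat}.

Definition partial (V : normedModType R) (a : 'I_m) (f : 'rV[R]_m -> V) :
  'rV[R]_m -> V := fun x => 'D_(delta_mx 0 a) f x.

(* C^k on an open set U; the values of f outside U are irrelevant. *)
Fixpoint Ck_on (V : normedModType R) (k : nat) (U : set 'rV[R]_m)
    (f : 'rV[R]_m -> V) : Prop :=
  (forall x, U x -> {for x, continuous f}) /\
  if k is k'.+1 then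
    forall a : 'I_m, (forall x, U x -> derivable f x (delta_mx 0 a)) /\
      Ck_on k' U (partial a f)
  else True.

Definition smooth_on (V : normedModType R) (U : set 'rV[R]_m)
  (f : 'rV[R]_m -> V) : Prop := forall k, Ck_on k U f.

End Smooth.

(* A smooth m-manifold without boundary together with a Riemannian metric.
   The manifold topology is that of the metric space M (hence Hausdorff); that
   [mdist] is the Riemannian distance is the separate predicate
   [riemannian_distance] below.  An atlas, not necessarily maximal, is given by
   charts [chart i], defined on the open sets [chart_dom i], with inverses
   [chart_inv i]; tangent vectors are row vectors in chart coordinates, and
   [gmx i x] is the Gram matrix at the point of coordinates x in chart i.
   Functions are total, their values off the relevant open sets being junk. *)
Record riemannian_structure (R : realType) (M : metricType R) (m : nat) := {
  chart_index : Type ;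
  chart_dom : chart_index -> set M ;
  chart : chart_index -> M -> 'rV[R]_m ;
  chart_inv : chart_index -> 'rV[R]_m -> M ;
  gmx : chart_index -> 'rV[R]_m -> 'M[R]_m ;
  chart_cover : forall p, exists i, chart_dom i p ;
  chart_dom_open : forall i, open (chart_dom i) ;
  chart_img_open : forall i, open (chart i @` chart_dom i) ;
  chartK : forall i p, chart_dom i p -> chart_inv i (chart i p) = p ;
  chart_continuous : forall i p, chart_dom i p -> {for p, continuous (chart i)} ;
  chart_inv_continuous : forall i x, (chart i @` chart_dom i) x ->
    {for x, continuous (chart_inv i)} ;
  chart_compat : forall i j,
    smooth_on (chart i @` (chart_dom i `&` chart_dom j))
      (chart j \o chart_inv i) ;
  gmx_sym : forall i x, (chart i @` chart_dom i) x -> (gmx i x)^T = gmx i x ;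
  gmx_posdef : forall i x (v : 'rV[R]_m), (chart i @` chart_dom i) x -> v != 0 ->
    0 < (v *m gmx i x *m v^T) 0 0 ;
  gmx_smooth : forall i, smooth_on (chart i @` chart_dom i) (gmx i) ;
  (* v *m 'J tau x is the image of the tangent vector v in chart j *)
  gmx_compat : forall i j x, (chart i @` (chart_dom i `&` chart_dom j)) x ->
    let tau := chart j \o chart_inv i in
    gmx i x = 'J tau x *m gmx j (tau x) *m ('J tau x)^T
}.

Section Riemannian.
Context {R : realType} {M : metricType R} {m : nat}.
Variable g : riemannian_structure M m.
Implicit Types (i : chart_index g) (x u v : 'rV[R]_m) (gamma : R -> M).

Definition chart_img i : set 'rV[R]_m := chart i @` chart_dom i.

Definition chart_at (p : M) : chart_index g := projT1 (cid (chart_cover g p)).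

Definition inner i x u v : R := (u *m gmx i x *m v^T) 0 0.

Definition C1_curve gamma : Prop :=
  continuous gamma /\
  forall i t, chart_dom i (gamma t) ->
    derivable (chart i \o gamma) t 1 /\
    {for t, continuous (derive1 (chart i \o gamma))}.

(* By [gmx_compat] the choice of the chart around [gamma t] does not matter. *)
Definition speed gamma (t : R) : R :=
  let i := chart_at (gamma t) in
  let v := derive1 (chart i \o gamma) t in
  Num.sqrt (inner i (chart i (gamma t)) v v).

Definition arc_length gamma : \bar R :=
  (\int[lebesgue_measure]_(t in `[0%R, 1%R]) (speed gamma t)%:E)%E.

(* [curve_length p q l]: some piecewise C^1 curve from p to q has length l.
   Each C^1 piece is reparametrized by [0, 1] and, without loss of generality,
   is the restriction of a curve which is C^1 on the whole real line. *)
Inductive curve_length (p : M) : M -> \bar R -> Prop :=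
| curve_length_nil : curve_length p p 0%E
| curve_length_rcons gamma l : curve_length p (gamma 0) l -> C1_curve gamma ->
    curve_length p (gamma 1) (l + arc_length gamma)%E.

Definition riemannian_distance : Prop :=
  forall p q : M, (mdist p q)%:E = ereal_inf [set l | curve_length p q l].

(* Christoffel symbol Gamma^k_{ab} *)
Definition christoffel i (k a b : 'I_m) x : R :=
  2^-1 * \sum_(l < m) invmx (gmx i x) k l *
    (partial a (fun y => gmx i y b l) x + partial b (fun y => gmx i y a l) x
     - partial l (fun y => gmx i y a b) x).

Definition geodesic_on (J : set R) gamma : Prop :=
  forall t, J t -> {for t, continuous gamma} /\
    forall i, chart_dom i (gamma t) ->
      let c := chart i \o gamma in
      [/\ derivable c t 1, derivable (derive1 c) t 1 &
          forall k, (derive1 (derive1 c) t) 0 k +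
            \sum_(a < m) \sum_(b < m)
              christoffel i k a b (c t) *
                (derive1 c t) 0 a * (derive1 c t) 0 b = 0].

Definition geodesically_complete : Prop :=
  forall (J : set R) gamma, open J -> is_interval J -> geodesic_on J gamma ->
    exists gamma', geodesic_on setT gamma' /\
      forall t, J t -> gamma' t = gamma t.

(* Coordinates of the curvature tensor, R(d_a, d_b) d_c = sum_l R_{abc}^l d_l,
   for R(X, Y) Z = D_X D_Y Z - D_Y D_X Z - D_[X, Y] Z. *)
Definition curvature i (a b c l : 'I_m) x : R :=
  partial a (christoffel i l b c) x - partial b (christoffel i l a c) x +
  \sum_(s < m) (christoffel i s b c x * christoffel i l a s x -
                christoffel i s a c x * christoffel i l b s x).

(* R(u, v) w *)
Definition curvature_op i x u v (w : 'rV[R]_m) : 'rV[R]_m :=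
  \row_(l < m) \sum_(a < m) \sum_(b < m) \sum_(c < m)
    u 0 a * v 0 b * w 0 c * curvature i a b c l x.

Definition sectional_curvature i x u v : R :=
  inner i x (curvature_op i x u v v) u /
  (inner i x u u * inner i x v v - inner i x u v ^+ 2).

Definition sectional_curvatures : set R :=
  [set K | exists i x u v, [/\ chart_img i x, row_free (col_mx u v) &
                               K = sectional_curvature i x u v]].

End Riemannian.

Definition separable (T : topologicalType) : Prop :=
  exists D : set T, countable D /\ dense D.

Section Breakdown.
Context {R : realType} {M : metricType R}.

(* Surjectivity is not required. *)
Definition isometry (psi : M -> M) : Prop :=
  forall x y, mdist (psi x) (psi y) = mdist x y.

Definition homogeneous : Prop :=
  forall p q : M, exists psi, isometry psi /\ q = psi p.

Definition unbounded : Prop :=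
  forall C : R, exists p q : M, C < mdist p q.

Definition isometric_equivariant (n : nat) (mn : n.-tuple M -> M) : Prop :=
  forall psi, isometry psi -> forall X : n.-tuple M,
    psi (mn X) = mn (map_tuple psi X).

(* The k replaced entries are arbitrary; they may coincide with the old ones. *)
Definition corruption (n k : nat) (X Y : n.-tuple M) : Prop :=
  exists A : {set 'I_n}, #|A| = k /\
    forall j, j \notin A -> tnth Y j = tnth X j.

(* Equal to +oo if no k qualifies. *)
Definition breakdown_point (n : nat) (mn : n.-tuple M -> M) (X : n.-tuple M) :
    \bar R :=
  ereal_inf [set e | exists k : nat, [/\ (1 <= k <= n)%N,
    ereal_sup [set (mdist (mn X) (mn Y))%:E | Y in corruption k X] = +oo%E &
    e = (k%:R / n%:R)%:E]].

End Breakdown.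

Arguments homogeneous {R} M.
Arguments unbounded {R} M.

(* Main.v *)
Require Import Defs.
From HB Require Import structures.
From mathcomp Require Import all_boot all_order all_algebra.
From mathcomp Require Import all_classical all_reals all_analysis.
From mathcomp Require Import lra zify.

(** The breakdown bound rests on one construction.  Let k be the floor of
    (n + 1) / 2, so that n <= 2k, and cover the index set by two sets A and A'
    of size k.  Given a surjective isometry psi, replace each x_j with j in A'
    by a preimage of x_j under psi.  The resulting sample Y differs from X only
    on A', while psi(Y) agrees with X on A' and hence differs from X only on A:
    both are k-corruptions of X.  If k corrupted entries could move the
    estimate by at most C, then both mn(Y) and mn(psi(Y)) = psi(mn(Y)) would be
    within C of mn(X), and psi would move mn(X) by at most 2C.  As M is
    homogeneous and unbounded, psi can be chosen to move mn(X) arbitrarily far,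
    so the supremum over k-corruptions is infinite
    ([ereal_sup_corruption_infty]).

    An isometry is only required to preserve distances, so its surjectivity has
    to be proved ([isometry_surjective]).  Local compactness of M, read off from
    a chart, is used at a single point q only.  If an isometry theta fixes q,
    the orbit of a point y close to q stays in a compact neighbourhood K of q;
    two terms of the orbit are therefore arbitrarily close to each other, and
    cancelling iterates of theta, so are y and some later term of its orbit.
    Hence y lies in the closed set theta(K) ([compact_orbit_image]).
    Homogeneity carries this from q to all other points, for balls of one fixed
    radius r: the range of an isometry psi contains the ball of radius r around
    each psi(p).  A nonempty set that contains the ball of radius r around each
    of its points is open and closed, so it is all of the connected space M. *)

Set Implicit Arguments.
Unset Strict Implicit.
Unset Printing Implicit Defensive.

Import Order.TTheory GRing.Theory Num.Theory.
Import numFieldNormedType.Exports.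

Local Open Scope classical_set_scope.
Local Open Scope ring_scope.

Local Notation isometry := Defs.isometry.

(** * Isometries of metric spaces *)

Section Isometries.
Context {R : realType} {M : metricType R}.
Implicit Types (psi : M -> M) (K : set M) (p q y : M).

Lemma isometry_inj psi : isometry psi -> injective psi.
Proof.
move=> isom x y psixy; apply: (@mdist_positivity R).
by rewrite -isom psixy mdistxx.
Qed.

Lemma isometry_comp psi phi :
  isometry psi -> isometry phi -> isometry (psi \o phi).
Proof. by move=> ipsi iphi x y /=; rewrite ipsi iphi. Qed.

Lemma isometry_iter psi k : isometry psi -> isometry (iter k psi).
Proof. by move=> isom x y; elim: k => //= k <-; rewrite isom. Qed.

Lemma isometry_continuous psi : isometry psi -> continuous psi.
Proof.
move=> isom x; apply/metricType_numDomainType.cvgrPdist_lt => e e0; near=> y.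
by rewrite isom; near: y; apply/metricType_numDomainType.nbhs_mdistP; exists e.
Unshelve. all: by end_near. Qed.

(** The orbit has a cluster point, so it returns arbitrarily close to an earlier
    term [iter i psi y]; cancelling [iter i psi] shows that it returns
    arbitrarily close to [y] itself.  As the returning terms belong to the
    closed set [psi @` K], so does [y]. *)
Lemma compact_orbit_image psi K y : isometry psi -> compact K ->
  (forall k, K (iter k psi y)) -> (psi @` K) y.
Proof.
move=> isom cK orbK.
have clK : closed (psi @` K).
  apply: compact_closed; first exact: metric_hausdorff.
  apply: continuous_compact cK.
  by apply: continuous_subspaceT; exact: isometry_continuous.
apply: clK => B /nbhs_ballP[e /= e0 yeB].
have [|c [_ clc]] := cK ((fun k => iter k psi y) @ \oo) _.
  by exists 0%N => // k _; exact: orbK.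
have e20 : 0 < e / 2 by rewrite divr_gt0.
have late N : exists2 k, (N <= k)%N & mdist c (iter k psi y) < e / 2.
  have := clc [set z | exists2 k, (N <= k)%N & z = iter k psi y] (ball c (e / 2)).
  case; first by exists N => // k /= Nk; exists k.
    exact: nbhsx_ballx.
  by move=> z [[k Nk ->]]; rewrite ballEmdist => ?; exists k.
have [i _ ci] := late 0%N.
have [j ij cj] := late i.+1.
have jE : j = (i + (j - i.+1).+1)%N by lia.
exists (iter (j - i.+1).+1 psi y); split.
  by exists (iter (j - i.+1) psi y); first exact: orbK.
apply: yeB; rewrite ballEmdist.
change (mdist y (iter (j - i.+1).+1 psi y) < e).
rewrite -(isometry_iter i isom) -iterD -jE.
apply: le_lt_trans (metric_triangle _ c _) _.
by rewrite metric_sym [e]splitr ltrD.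
Qed.

(** The isometries [alpha] and [beta] supplied by homogeneity turn [psi] into an
    isometry [beta \o psi \o alpha] that fixes [q], whose orbits cannot leave
    the balls centred at [q]. *)
Lemma homogeneous_ball_range K q r psi p : homogeneous M ->
  compact K -> ball q r `<=` K -> isometry psi ->
  ball (psi p) r `<=` range psi.
Proof.
move=> hom cK qrK ipsi z; rewrite ballEmdist /= => pz.
have [alpha [ialpha pE]] := hom q p.
have [beta [ibeta qE]] := hom (psi p) q.
pose theta := beta \o (psi \o alpha).
have itheta : isometry theta by do 2!apply: isometry_comp => //.
have thetaq k : iter k theta q = q.
  by elim: k => //= k ->; rewrite /theta /= -pE -qE.
have [k|w Kw] := @compact_orbit_image theta K (beta z) itheta cK.
  apply: qrK; rewrite ballEmdist /= -(thetaq k) (isometry_iter k itheta).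
  by rewrite qE ibeta.
by move=> /(isometry_inj ibeta) <-; exists (alpha w).
Qed.

(** Surjectivity fails for general metric spaces; here the range of [psi] is
    clopen because it contains a ball of fixed radius around each of its
    points. *)
Lemma isometry_surjective K q psi : connected [set: M] -> homogeneous M ->
  compact K -> nbhs q K -> isometry psi -> forall y, range psi y.
Proof.
move=> conM hom cK /nbhs_ballP[r /= r0 qrK] ipsi y.
have balls p := homogeneous_ball_range (p := p) hom cK qrK ipsi.
suff rangeT : range psi = [set: M] by have : setT y by []; rewrite -rangeT.
apply: conM; first by exists (psi y); exists y.
- exists (range psi); last by rewrite setTI.
  rewrite openE => _ [p _ <-]; apply/nbhs_ballP; exists r => //=.
- exists (range psi); last by rewrite setTI.
  move=> z /(_ _ (nbhsx_ballx z r r0))[_ [[p _ <-] zp]].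
  exact: balls (ball_sym zp).
Qed.

Lemma unbounded_from (p : M) (C : R) : unbounded M -> exists q, C < mdist p q.
Proof.
move=> /(_ (C + C))[a [b ab]].
have := metric_triangle a p b; rewrite (metric_sym a p).
have [Ca|aC] := ltP C (mdist p a); first by exists a.
by exists b; lra.
Qed.

End Isometries.

(** * Local compactness of manifolds *)

(** The inverse of a chart carries a closed ball of coordinate space to a compact
    neighbourhood. *)
Lemma riemannian_compact_nbhs (R : realType) (M : metricType R) (m : nat)
    (g : riemannian_structure M m) (p : M) :
  exists2 K : set M, compact K & nbhs p K.
Proof.
have [i ip] := chart_cover g p.
have /nbhs_ballP[e /= e0 eU] : nbhs (chart i p) (chart i @` chart_dom i).
  by apply: open_nbhs_nbhs; split; [exact: chart_img_open|exists p].
have e20 : 0 < e / 2 by rewrite divr_gt0.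
pose K0 := closed_ball (chart i p) (e / 2).
have K0U : K0 `<=` chart i @` chart_dom i.
  by apply: subset_trans eU; apply: closed_ball_subset => //; lra.
exists (chart_inv i @` K0).
  apply: continuous_compact.
    apply: continuous_in_subspaceT => x /set_mem /K0U.
    exact: chart_inv_continuous.
  apply: bounded_closed_compact; last exact: closed_ball_closed.
  exists (`|chart i p| + e / 2); split; first exact: num_real.
  move=> N /ltW eN x; rewrite /K0 closed_ballE // => xe; apply: le_trans eN.
  by rewrite -[x](subKr (chart i p)) (le_trans (ler_normB _ _)) // lerD2l.
have near_p : nbhs p (chart i @^-1` ball (chart i p) (e / 2)).
  by apply: chart_continuous => //; exact: nbhsx_ballx.
have dom_p : nbhs p (chart_dom i).
  by apply: open_nbhs_nbhs; split; first exact: chart_dom_open.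
apply: filterS (filterI near_p dom_p) => y [ye iy].
exists (chart i y); last exact: chartK.
exact: subset_closed_ball.
Qed.

(** * Breakdown of equivariant estimators *)

(** Two sets of size [k] cover the indices as soon as [n <= k + k]: take the
    first [k] indices and the last [k]. *)
Lemma ord_cover_two_sets (n k : nat) : (k <= n <= k + k)%N ->
  exists A B : {set 'I_n},
    [/\ #|A| = k, #|B| = k & forall j, j \notin A -> j \in B].
Proof.
move=> /andP[kn n2k].
pose A := [set widen_ord kn j | j : 'I_k]%SET.
have cA : #|A| = k.
  by rewrite card_imset ?card_ord // => i j /(congr1 val) /= /val_inj.
have inA (j : 'I_n) : (j < k)%N -> j \in A.
  by move=> jk; apply/imsetP; exists (Ordinal jk) => //; exact: val_inj.
exists A, [set rev_ord j | j in A]%SET; split => //.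
  by rewrite card_imset //; exact: rev_ord_inj.
move=> j jA; apply/imsetP; exists (rev_ord j); last by rewrite rev_ordK.
have kj : (k <= j)%N by rewrite leqNgt; apply: contra jA; exact: inA.
by apply: inA => /=; have := ltn_ord j; lia.
Qed.

(** With the indices covered by [A] and [B], solve [psi y_j = x_j] for [j] in [B]
    and keep [y_j = x_j] elsewhere: [Y] is corrupted on [B] only, and applying
    [psi] repairs these entries, leaving only entries in [A] to be corrupted. *)
Lemma corruption_pair (R : realType) (M : metricType R) (n k : nat)
    (psi : M -> M) (X : n.-tuple M) :
  (k <= n <= k + k)%N -> (forall y, range psi y) ->
  exists2 Y, corruption k X Y & corruption k X (map_tuple psi Y).
Proof.
move=> /ord_cover_two_sets[A [B [cA cB AB]]] surj.
have /choice[inv invK] : forall y, exists x, psi x = y.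
  by move=> y; have [x _ <-] := surj y; exists x.
pose Y := [tuple if j \in B then inv (tnth X j) else tnth X j | j < n].
exists Y.
  by exists B; split => // j jB; rewrite tnth_mktuple (negbTE jB).
exists A; split => // j /AB jB.
by rewrite tnth_map tnth_mktuple jB invK.
Qed.

(** If the deviations were bounded by [C], the isometry [psi] would displace
    [mn X] by at most [C + C], through the intermediate point [psi (mn Y)]. *)
Lemma ereal_sup_corruption_infty (R : realType) (M : metricType R) (n k : nat)
    (mn : n.-tuple M -> M) (X : n.-tuple M) :
  (k <= n <= k + k)%N -> unbounded M -> homogeneous M ->
  (forall psi : M -> M, isometry psi -> forall y, range psi y) ->
  isometric_equivariant mn ->
  ereal_sup [set (mdist (mn X) (mn Y))%:E | Y in corruption k X] = +oo%E.
Proof.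
move=> kn unbM hom surj equiv.
rewrite -(image_comp (fun Y => mdist (mn X) (mn Y)) EFin); apply: hasNub_ereal_sup.
- move=> [C ubC].
  have [q Cq] := unbounded_from (mn X) (C + C) unbM.
  have [psi [ipsi qE]] := hom (mn X) q.
  have [Y XY XpsiY] := corruption_pair X kn (surj _ ipsi).
  have dY : mdist (mn X) (mn Y) <= C by apply: ubC; exists Y.
  have dpsiY : mdist (mn X) (psi (mn Y)) <= C.
    by rewrite equiv //; apply: ubC; exists (map_tuple psi Y).
  have := metric_triangle (mn X) (psi (mn Y)) q.
  by rewrite qE ipsi -qE (metric_sym (mn Y)); lra.
- have [Y XY _] := corruption_pair X kn (surj id (fun _ _ => erefl)).
  by exists (mdist (mn X) (mn Y)); exists Y.
Qed.

Theorem theorem7 (R : realType) (M : metricType R) (m : nat)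
    (g : riemannian_structure M m)
    (g_dist : riemannian_distance g)
    (g_complete : geodesically_complete g)
    (M_connected : connected [set: M]%classic)
    (M_separable : separable M)
    (curv_ub : (ereal_sup [set K%:E | K in sectional_curvatures g]%classic
                  < +oo)%E)
    (curv_lb : (-oo < ereal_inf
                  [set K%:E | K in sectional_curvatures g]%classic)%E)
    (M_unbounded : unbounded M)
    (M_homogeneous : homogeneous M)
    (n : nat) (n_gt0 : (0 < n)%N)
    (mn : n.-tuple M -> M) (mn_equiv : isometric_equivariant mn)
    (X : n.-tuple M) :
  (breakdown_point mn X <= (((n + 1) %/ 2)%:R / n%:R)%:E)%E.
Proof.
have [p [_ _]] := M_unbounded 0.
have [K cK pK] := riemannian_compact_nbhs g p.
apply: ereal_inf_lbound; exists ((n + 1) %/ 2)%N; split => //; first by lia.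
apply: ereal_sup_corruption_infty => //; first by lia.
move=> psi; exact: isometry_surjective cK pK.
Qed.
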